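(* The solution $f(x)=\sum_{n\geq0}f_nx^n\in\mathbb{C}[[x]]$ with $f_0=1$ of the Z-Mahler equation $(1-x)f(x)=\Phi(f(x))$, where $\Phi$ is the Z-Mahler operator, is not Z-regular.
   Context: Zeckendorf numeration: let $F_{-2}=0$, $F_{-1}=1$, $F_n=F_{n-1}+F_{n-2}$ for $n\geq 0$. Every $n\in\mathbb{N}$ has a unique expansion $n=\sum_{i=0}^k b_iF_i$ with $b_i\in\{0,1\}$, no two consecutive digits $1$ and no leading zeros; $(n)_Z=b_k\cdots b_0$. Define $\phi(\sum_i b_iF_i)=\sum_i b_iF_{i+1}$ where $(n)_Z=b_k\cdots b_0$, and $\Phi(\sum f_nx^n)=\sum f_nx^{\phi(n)}$. Weighted automaton over a commutative ring $R$ (here $R=\mathbb{C}$): $\mathcal{A}=(S,B,\Delta,I,F)$ with $S$ a finite set, $I,F:S\to R$ and $\Delta:S\times B\times S\to R$. A path labelled $b_1\cdots b_n$ through $s_0,\dots,s_n$ has weight $I(s_0)\prod_i\Delta(s_{i-1},b_i,s_i)F(s_n)$. $\mathrm{weight}_{\mathcal{A}}(w)$ is the sum of the weights of all paths labelled $w$. A series $f=\sum f_nx^n$ is Z-regular if there is a weighted automaton with $B=\{0,1\}$ such that $f_n=\mathrm{weight}_{\mathcal{A}}((n)_Z)$ for all $n\ge0$, with $(n)_Z$ read from the most significant digit. *)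

(* Defs.v *)
From HB Require Import structures.
From mathcomp Require Import all_boot all_order all_algebra zify.
From mathcomp Require Import reals.
From mathcomp Require Export complex.

Set Implicit Arguments.
Unset Strict Implicit.
Unset Printing Implicit Defensive.

Import GRing.Theory.

(* The Zeckendorf sequence starts at index -2 with F_(-2) = 0, F_(-1) = 1;
   [fib k] is F_(k-2), and only the nonnegative indices carry digits. *)
Fixpoint fib (k : nat) : nat :=
  if k is k1.+1 then (if k1 is k2.+1 then fib k1 + fib k2 else 1) else 0.

Definition zF (n : nat) : nat := fib n.+2.

(* Words are read from the most significant digit: in w = b_k ... b_0 the
   digit b_i has position [size w - 1 - i]. *)
Definition digit (w : seq bool) (i : nat) : bool := nth false (rev w) i.

Definition zval (w : seq bool) : nat := \sum_(i < size w) digit w i * zF i.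

Definition nadj (b c : bool) : bool := ~~ (b && c).

(* 0 is represented by the empty word. *)
Definition zeck_word (w : seq bool) : bool :=
  head true w && sorted nadj w.

Fixpoint greedy (k n : nat) : seq bool :=
  if k is k'.+1 then
    if zF k' <= n then true :: greedy k' (n - zF k')
    else false :: greedy k' n
  else [::].

Fixpoint strip (w : seq bool) : seq bool :=
  if w is false :: w' then strip w' else w.

(* (n)_Z; its characterization by [zeck_word] and [zval] is [zeckP]. *)
Definition zeck (n : nat) : seq bool := strip (greedy n n).

Definition zphi (n : nat) : nat :=
  \sum_(i < size (zeck n)) digit (zeck n) i * zF i.+1.

Lemma zFS n : zF n.+2 = zF n.+1 + zF n.
Proof. by []. Qed.

Lemma ltn_zF n : n < zF n.
Proof.
suff: (n < zF n) && (n.+1 < zF n.+1) by case/andP.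
elim: n => [//|n /andP[h1 h2]]; rewrite h2 zFS; lia.
Qed.

Lemma zF_leS n : zF n <= zF n.+1.
Proof. by case: n => [//|n]; rewrite zFS leq_addr. Qed.

Lemma zval_cons b w : zval (b :: w) = b * zF (size w) + zval w.
Proof.
rewrite /zval /= big_ord_recr /= /digit rev_cons nth_rcons size_rev ltnn eqxx.
rewrite addnC; congr (_ + _); apply: eq_bigr => i _.
by rewrite nth_rcons size_rev ltn_ord.
Qed.

Lemma zval_nil : zval [::] = 0.
Proof. by rewrite /zval big_ord0. Qed.

Lemma zval_path b w : path nadj b w ->
  if b then zval w + zF (size w) < zF (size w).+1 else zval w < zF (size w).
Proof.
elim: w b => [|c w IH] b /=; first by rewrite zval_nil; case: b.
move=> /andP[+ /IH]; rewrite zval_cons zFS.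
by case: b c => [] [] //= _; have := zF_leS (size w); lia.
Qed.

Lemma zval_sorted_lt w : sorted nadj w -> zval w < zF (size w).
Proof.
move=> h; apply: (@zval_path false).
by case: w h => [|b w].
Qed.

Lemma greedy_zval w : sorted nadj w -> greedy (size w) (zval w) = w.
Proof.
elim: w => [//|b w IH] hs; have hw := path_sorted hs.
rewrite /= zval_cons; case: b {hs} => /=.
  by rewrite mul1n leq_addr addKn IH.
by rewrite mul0n add0n leqNgt zval_sorted_lt //= IH.
Qed.

Lemma size_greedy k n : size (greedy k n) = k.
Proof. by elim: k n => [//|k IH] n /=; case: ifP => _ /=; rewrite IH. Qed.

Lemma greedyP k n : n < zF k ->
  sorted nadj (greedy k n) /\ zval (greedy k n) = n.
Proof.
elim/ltn_ind: k n => -[|k] IH n hn /=.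
  by rewrite zval_nil; move: hn; rewrite ltnS leqn0 => /eqP.
case: leqP => hk.
  have hlt : n - zF k < zF k.
    by case: k hk hn {IH} => [|k]; rewrite ?zFS; [rewrite /zF /=|have := zF_leS k]; lia.
  have [s v] := IH k (ltnSn _) _ hlt.
  rewrite zval_cons size_greedy v mul1n subnKC //; split=> //.
  case: k hk hn hlt {IH} s {v} => [//|k] hk hn hlt /=.
  by rewrite zFS in hn; rewrite leqNgt ltn_subLR //= hn.
have [s v] := IH k (ltnSn _) _ hk.
rewrite zval_cons v mul0n add0n; split=> //.
by case: (greedy k n) s.
Qed.

Lemma zval_strip w : zval (strip w) = zval w.
Proof. by elim: w => [//|[] w IH] //=; rewrite zval_cons IH. Qed.

Lemma head_strip w : head true (strip w).
Proof. by elim: w => [|[] w]. Qed.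

Lemma sorted_strip w : sorted nadj w -> sorted nadj (strip w).
Proof. by elim: w => [//|[] w IH] //= /path_sorted. Qed.

Lemma strip_nseq k w : head true w -> strip (nseq k false ++ w) = w.
Proof. by move=> hw; elim: k => //=; case: w hw => [|[] w]. Qed.

Lemma zval_nseq k w : zval (nseq k false ++ w) = zval w.
Proof. by elim: k => [//|k IH] /=; rewrite zval_cons IH. Qed.

Lemma sorted_nseq k w : sorted nadj w -> sorted nadj (nseq k false ++ w).
Proof.
by move=> hw; elim: k => //= k; case: (nseq k false ++ w).
Qed.

Lemma zeckP n w : reflect (w = zeck n) (zeck_word w && (zval w == n)).
Proof.
apply: (iffP idP) => [/andP[/andP[hh hs] /eqP <-]|->]; last first.
  have [s v] := greedyP (ltn_zF n).
  by rewrite /zeck_word head_strip sorted_strip //= zval_strip v.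
have hsz : size w <= zval w.
  case: w hh {hs} => [//|[] w] // _.
  by rewrite zval_cons mul1n /=; have := ltn_zF (size w); lia.
have hg := greedy_zval (sorted_nseq (zval w - size w) hs).
rewrite size_cat size_nseq subnK // zval_nseq in hg.
by rewrite /zeck hg strip_nseq.
Qed.

Lemma zval_zeck n : zval (zeck n) = n.
Proof. by have /zeckP/andP[_ /eqP] : zeck n = zeck n by []. Qed.

Lemma leq_zphi n : n <= zphi n.
Proof.
rewrite -{1}(zval_zeck n) /zphi /zval; apply: leq_sum => i _.
by rewrite leq_mul2l zF_leS orbT.
Qed.

Record wautomaton (R : comPzRingType) (B : Type) := WAutomaton {
  state : finType;
  trans : state -> B -> state -> R;
  initial : state -> R;
  final : state -> R }.

Section Weight.
Local Open Scope ring_scope.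
Variables (R : comPzRingType) (B : Type) (A : wautomaton R B).

Definition path_weight (w : seq B) (s : (size w).+1.-tuple (state A)) : R :=
  initial (tnth s ord0)
  * (\prod_(i < size w)
       trans (tnth s (widen_ord (leqnSn _) i)) (tnth (in_tuple w) i)
             (tnth s (lift ord0 i)))
  * final (tnth s ord_max).

Definition weight (w : seq B) : R :=
  \sum_(s : (size w).+1.-tuple (state A)) path_weight s.

End Weight.

(* f : fps R stands for the formal power series \sum_n (f n) x^n. *)
Definition fps (R : Type) : Type := nat -> R.

Section Series.
Local Open Scope ring_scope.

Definition fps_mul (R : comPzRingType) (f g : fps R) : fps R :=
  fun n => \sum_(i < n.+1) f i * g (n - i)%N.

Definition fps_of_poly (R : comNzRingType) (p : {poly R}) : fps R :=
  fun n => p`_n.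

(* The coefficient of x^m in \sum_n (f n) x^(zphi n); by [leq_zphi] only the
   n <= m can contribute. *)
Definition ZMahler (R : comPzRingType) (f : fps R) : fps R :=
  fun m => \sum_(n < m.+1 | zphi n == m) f n.

Definition Zregular (R : comPzRingType) (f : fps R) : Prop :=
  exists A : wautomaton R bool, forall n, f n = weight A (zeck n).

End Series.

(* Main.v *)
Require Import Defs.
From mathcomp Require Import all_boot all_order all_algebra.
From mathcomp Require Import reals complex.
From mathcomp Require Import boolp zify.
Import GRing.Theory.
Local Open Scope ring_scope.

(* Writing phi for [zphi], the equation says
   f_(n+1) = f_n + \sum_(phi(m) = n+1) f_m, which determines f from f_0 = 1
   because phi(m) > m for m > 0.  Summing up,
   f_n = \sum_(phi(m) <= n) f_m, so phi(m) <= 2m and monotonicity give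
   f_(4n) >= f_0 + ... + f_(2n) >= n f_n, whence f_(4^k) >= 2^(k(k-1)).  A
   weighted automaton only produces weights that are at most exponential in the
   length of the word, and (4^k)_Z has length O(k), so f is not Z-regular. *)

(** * Size estimates for [zF], [zphi] and Zeckendorf words *)

Section Growth.
Local Open Scope nat_scope.

(** The least ratio of consecutive [zF] is 3/2, attained at n = 1. It makes [zphi] strictly increase
    every positive argument. *)
Lemma zF_ge n : 3 * zF n <= 2 * zF n.+1.
Proof.
suff: (3 * zF n <= 2 * zF n.+1) && (3 * zF n.+1 <= 2 * zF n.+2).
  by case/andP.
by elim: n => [//|n /andP[h1 h2]]; rewrite h2 /=; rewrite !zFS in h2 *; lia.
Qed.

Lemma zF_le2 n : zF n.+1 <= 2 * zF n.
Proof. by case: n => [//|n]; have := zF_leS n; rewrite zFS; lia. Qed.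

Lemma zphi_ge n : 3 * n <= 2 * zphi n.
Proof.
rewrite -{1}(zval_zeck n) /zphi /zval !big_distrr /=.
by apply: leq_sum => i _; rewrite !(mulnCA _ (nat_of_bool _)) leq_mul2l zF_ge orbT.
Qed.

Lemma zphi_le2 n : zphi n <= 2 * n.
Proof.
rewrite -{2}(zval_zeck n) /zphi /zval big_distrr /=.
by apply: leq_sum => i _; rewrite (mulnCA _ (nat_of_bool _)) leq_mul2l zF_le2 orbT.
Qed.

Lemma zphi0 : zphi 0 = 0.
Proof. by have := zphi_le2 0; lia. Qed.

Lemma size_zeck_leq n j : n < zF j -> size (zeck n) <= j.
Proof.
have mono : {homo zF : i k / i <= k} by apply: homo_leq leq_trans zF_leS => //.
have /zeckP/andP[/andP[hh _] /eqP] : zeck n = zeck n by [].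
case: (zeck n) hh => [//|[] w] // _; rewrite zval_cons => <- /= hj.
by rewrite ltnNge; apply/negP => /mono; lia.
Qed.

Lemma size_zeck_exp4 k : size (zeck (4 ^ k)) <= 4 * k + 1.
Proof.
apply: size_zeck_leq.
(* Four index steps multiply [zF] by at least 5: zF(i+4) = 3 zF(i+1) + 2 zF(i). The offset 1 serves
   k = 0, as zF 0 = 1. *)
elim: k => [//|k IH].
have -> : 4 * k.+1 + 1 = (4 * k + 1).+4 by lia.
by have := zF_leS (4 * k + 1); rewrite !zFS expnS; lia.
Qed.

(** Since phi(n+1) > n+1, the top index never contributes; this turns the functional equation into a
    recursion. *)
Lemma sum_zphi_last (V : nmodType) (g : nat -> V) n :
  (\sum_(m < n.+2 | zphi m == n.+1) g m = \sum_(m < n.+1 | zphi m == n.+1) g m)%R.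
Proof.
rewrite [LHS]big_mkcond big_ord_recr /= -big_mkcond /= ifN ?addr0 //.
by have := zphi_ge n.+1; lia.
Qed.

(* The fuel [k] makes the recursion structural; its value is irrelevant once
   n < k. *)
Fixpoint zmahler_rec (k n : nat) : nat :=
  if k is k'.+1 then
    if n is n'.+1 then
      zmahler_rec k' n' + \sum_(m < n'.+1 | zphi m == n'.+1) zmahler_rec k' m
    else 1
  else 0.

Lemma zmahler_rec_fuel k l n :
  n < k -> n < l -> zmahler_rec k n = zmahler_rec l n.
Proof.
elim: k l n => [//|k IH] [//|l] [//|n] hk hl /=.
congr (_ + _); first exact: IH.
by apply: eq_bigr => m _; apply: IH; have := ltn_ord m; lia.
Qed.

Definition zmahler_coef (n : nat) : nat := zmahler_rec n.+1 n.

Lemma zmahler_coefS n :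
  zmahler_coef n.+1 =
    zmahler_coef n + \sum_(m < n.+1 | zphi m == n.+1) zmahler_coef m.
Proof.
congr (_ + _); apply: eq_bigr => m _.
exact: (@zmahler_rec_fuel n.+1 m.+1 m).
Qed.

(** * Superexponential growth of the coefficients *)

Lemma zmahler_coef_homo : {homo zmahler_coef : m n / m <= n}.
Proof.
by apply: homo_leq leq_trans _ => // n; rewrite zmahler_coefS leq_addr.
Qed.

Lemma zmahler_coef_sum n :
  zmahler_coef n = \sum_(m < n.+1 | zphi m <= n) zmahler_coef m.
Proof.
elim: n => [|n IH]; first by rewrite big_mkcond big_ord_recl big_ord0 /= zphi0.
rewrite zmahler_coefS {1}IH.
rewrite [RHS]big_mkcond big_ord_recr /= ifN ?addn0; last first.
  by have := zphi_ge n.+1; lia.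
rewrite -big_mkcond [RHS](bigID (fun m : 'I_n.+1 => zphi m == n.+1)) /= addnC.
by congr (_ + _); apply: eq_bigl => m; apply/idP/idP; lia.
Qed.

Lemma zmahler_coef_double n :
  \sum_(m < n.+1) zmahler_coef m <= zmahler_coef (2 * n).
Proof.
rewrite zmahler_coef_sum.
rewrite (big_ord_widen_cond (2 * n).+1 predT zmahler_coef); last by lia.
rewrite [X in X <= _]big_mkcond [X in _ <= X]big_mkcond /=.
apply: leq_sum => m _; case: ifP => // hm.
by rewrite ifT //; have := zphi_le2 m; lia.
Qed.

Lemma zmahler_coef_quadruple n :
  n * zmahler_coef n <= zmahler_coef (4 * n).
Proof.
have -> : 4 * n = 2 * (2 * n) by lia.
apply: leq_trans (zmahler_coef_double _).
(* Only the n+1 indices from n to 2n are kept; each term there is at least f_n. *)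
rewrite -(big_mkord predT zmahler_coef) (big_cat_nat (n := n)) //=; last by lia.
apply: leq_trans (leq_addl _ _).
apply: (@leq_trans (\sum_(n <= m < (2 * n).+1) zmahler_coef n)).
  by rewrite sum_nat_const_nat leq_mul2r; apply/orP; right; lia.
rewrite big_nat_cond [X in _ <= X]big_nat_cond; apply: leq_sum => m.
by case/andP=> /andP[/zmahler_coef_homo].
Qed.

(** Iterating the previous bound gives the product of the 4^j for j < k, whose exponent of 2 is 0 +
    2 + ... + 2(k-1). *)
Lemma zmahler_coef_exp4 k : 2 ^ (k * k.-1) <= zmahler_coef (4 ^ k).
Proof.
elim: k => [//|k IH]; rewrite expnS.
apply: leq_trans (zmahler_coef_quadruple _).
have -> : k.+1 * k.+1.-1 = 2 * k + k * k.-1 by case: k {IH} => //= k; lia.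
by rewrite expnD expnM leq_mul2l IH orbT.
Qed.

Lemma zmahler_coef_not_exponential b :
  ~ forall n, zmahler_coef n <= b ^ (size (zeck n)).+2.
Proof.
(* This k gives k(k-1) > b(4k+3), where 4k+3 bounds the word length plus 2 and b < 2^b. *)
move=> hb; pose k := 4 * b + 4.
have /= := leq_trans (zmahler_coef_exp4 k) (hb (4 ^ k)).
have [-> | b0] := posnP b; first by rewrite exp0n // leqn0 expn_eq0.
move=> h.
have : 2 ^ (k * k.-1) <= 2 ^ (b * (4 * k + 3)).
  apply: leq_trans h _.
  apply: (@leq_trans (b ^ (4 * k + 3))).
    by apply: leq_pexp2l => //; have := size_zeck_exp4 k; lia.
  rewrite expnM leq_exp2r; last by lia.
  exact/ltnW/ltn_expl.
by rewrite leq_exp2l // /k; nia.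
Qed.

End Growth.

(** * The equation read coefficientwise *)

Lemma fps_mul_1subX (R : comNzRingType) (g : fps R) n :
  fps_mul (fps_of_poly (1 - 'X)) g n = if n is m.+1 then g n - g m else g n.
Proof.
rewrite /fps_mul /fps_of_poly; case: n => [|n].
  by rewrite big_ord_recl big_ord0 coefB coef1 coefX subr0 mul1r addr0 subn0.
rewrite !big_ord_recl big1 => [|i _]; last first.
  by rewrite coefB coef1 coefX subr0 mul0r.
by rewrite !coefB !coef1 !coefX /= subr0 sub0r mul1r mulN1r addr0 subn0 subn1.
Qed.

Lemma zmahler_eqP (R : comNzRingType) (g : fps R) :
  fps_mul (fps_of_poly (1 - 'X)) g = ZMahler g <->
  forall n, g n.+1 = g n + \sum_(m < n.+1 | zphi m == n.+1) g m.
Proof.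
split=> [h n|h].
  have := congr1 (@^~ n.+1) h.
  by rewrite /= fps_mul_1subX /ZMahler sum_zphi_last => <-; rewrite addrC subrK.
apply/funext => -[|n]; rewrite fps_mul_1subX /ZMahler.
  (* In degree 0 both sides are g_0, so g_0 stays free. *)
  by rewrite big_mkcond big_ord_recl big_ord0 /= zphi0 addr0.
by rewrite sum_zphi_last h addrC addKr.
Qed.

(** * Exponential bound on automaton weights *)

Section WeightBound.
Import Order.TTheory Num.Theory.

Lemma weight_norm_le (R : numDomainType) (A : wautomaton R bool) (b : nat) :
  (forall s : state A, `|initial s| <= b%:R) ->
  (forall (s t : state A) c, `|trans s c t| <= b%:R) ->
  (forall s : state A, `|final s| <= b%:R) ->
  forall w, `|weight A w| <= ((#|state A|.+1 * b) ^ (size w).+2)%:R.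
Proof.
move=> hI hT hF w.
(* A path has one factor per letter, plus an initial and a final one. *)
have hp s : `|path_weight (A := A) (w := w) s| <= (b ^ (size w).+2)%:R.
  rewrite /path_weight !normrM normr_prod expnSr expnS !natrM.
  rewrite ler_pM ?mulr_ge0 ?prodr_ge0 // ler_pM ?prodr_ge0 // natrX.
  rewrite -[X in _ ^+ X]card_ord -prodr_const.
  by apply: ler_prod => i _; rewrite normr_ge0 hT.
apply: le_trans (ler_norm_sum _ _ _) _.
apply: le_trans (ler_sum _ (fun s _ => hp s)) _.
rewrite sumr_const card_tuple -mulrnA ler_nat mulnC expnMn leq_mul2r.
(* The successor keeps the base positive even without states, so the exponent may be raised by
   one. *)
apply/orP; right; apply: (@leq_trans (#|state A|.+1 ^ (size w).+1)).
  by rewrite leq_exp2r.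
by rewrite leq_pexp2l.
Qed.

Lemma complex_norm_bound (R : realType) (z : R[i]) :
  exists b : nat, `|z| <= b%:R.
Proof.
(* The norm is itself an element of [R[i]]; its real part gives access to the Archimedean property
   of [R]. *)
exists (Num.bound `|complex.Re `|z| |).
rewrite -[`|z|](RRe_real (normr_real z)) -(rmorph_nat (real_complex R)) lecR.
apply: ltW; apply: le_lt_trans (ler_norm _) _.
exact: archi_boundP.
Qed.

Lemma complex_fun_bound (R : realType) (T : finType) (h : T -> R[i]) :
  exists b : nat, forall t, `|h t| <= b%:R.
Proof.
have [b hb] := choice (fun t => complex_norm_bound R (h t)).
exists (\max_t b t) => t.
by apply: le_trans (hb t) _; rewrite ler_nat leq_bigmax.
Qed.

Lemma Zregular_norm_le (R : realType) (f : fps R[i]) : Zregular f ->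
  exists b : nat, forall n, `|f n| <= (b ^ (size (zeck n)).+2)%:R.
Proof.
case=> A hA.
have [bI hI] := complex_fun_bound R _ (@initial _ _ A).
have [bT hT] := complex_fun_bound R _
  (fun x : state A * bool * state A => trans x.1.1 x.1.2 x.2).
have [bF hF] := complex_fun_bound R _ (@final _ _ A).
exists (#|state A|.+1 * (bI + bT + bF))%N => n; rewrite hA.
apply: weight_norm_le => [s|s t c|s].
- by apply: le_trans (hI s) _; rewrite ler_nat; lia.
- by apply: le_trans (hT (s, c, t)) _; rewrite ler_nat; lia.
- by apply: le_trans (hF s) _; rewrite ler_nat; lia.
Qed.

End WeightBound.

Theorem proposition38 (R : realType) :
  exists2 f : fps R[i],
    unique (fun g : fps R[i] =>
              g 0%N = 1 /\ fps_mul (fps_of_poly (1 - 'X)) g = ZMahler g) f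
    & ~ Zregular f.
Proof.
exists (fun n => (zmahler_coef n)%:R); last first.
  move=> /Zregular_norm_le[b hb]; apply: (zmahler_coef_not_exponential b) => n.
  by have := hb n; rewrite Num.Theory.normr_nat Num.Theory.ler_nat.
split=> [|g [g0 /zmahler_eqP gS]].
  by split=> //; apply/zmahler_eqP => n; rewrite zmahler_coefS natrD natr_sum.
apply/funext; elim/ltn_ind => -[|n] IH; first by rewrite g0.
rewrite gS zmahler_coefS natrD natr_sum IH //; congr (_ + _).
by apply: eq_bigr => m _; rewrite IH // ltnS ltnW.
Qed.
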